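(* There is a computable coloring $c:\mathbb{N}\to\{0,1\}$ such that for every infinite computable set $X\subseteq\mathbb{N}$, the set $\mathrm{FS}^{\leq 2}(X)$ is not monochromatic for $c$.
   Context: $\mathbb{N}$ denotes the set of positive integers. For a finite nonempty $F\subseteq\mathbb{N}$, $\sum F$ denotes the sum of the elements of $F$. For $X\subseteq\mathbb{N}$ and $n\geq 1$, $\mathrm{FS}^{\leq n}(X)=\{\sum F \mid F\subseteq X \text{ and } 1\leq |F|\leq n\}$. A set $Z\subseteq\mathbb{N}$ is monochromatic for a coloring $c$ if $c(x)=c(y)$ for all $x,y\in Z$. *)

(* Defs.v *)
From mathcomp Require Import all_boot finmap all_classical.

Set Implicit Arguments.
Unset Strict Implicit.
Unset Printing Implicit Defensive.

Local Open Scope classical_set_scope.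

(** Kleene's mu-recursive functions. A program is untyped: its arity is the
    length of the argument lists on which [eval] can relate it to a value. *)
Inductive program : Type :=
| Zero
| Succ
| Proj of nat
| Comp of program & seq program
| Rec of program & program
| Mu of program.

(** [eval p s y]: the partial function computed by [p] is defined on the
    arguments [s], with value [y]. *)
Inductive eval : program -> seq nat -> nat -> Prop :=
| eval_zero s : eval Zero s 0
| eval_succ x : eval Succ [:: x] x.+1
| eval_proj i s : i < size s -> eval (Proj i) s (nth 0 s i)
| eval_comp p qs s zs y :
    size zs = size qs ->
    (forall i, i < size qs -> eval (nth Zero qs i) s (nth 0 zs i)) ->
    eval p zs y -> eval (Comp p qs) s y
| eval_rec0 p q s y : eval p s y -> eval (Rec p q) (0 :: s) y
| eval_recS p q n s z y :
    eval (Rec p q) (n :: s) z -> eval q [:: n, z & s] y ->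
    eval (Rec p q) (n.+1 :: s) y
| eval_mu p s (v : nat -> nat) y :
    (* [p] must be defined, and nonzero, at every point below [y] *)
    (forall z, z < y -> eval p (z :: s) (v z).+1) ->
    eval p (y :: s) 0 -> eval (Mu p) s y.

(** Here the natural numbers start at [1], as in the paper. Colorings are
    functions on [nat] whose value at [0] is irrelevant. *)
Definition posnat : set nat := [set n | 0 < n].

Definition computable_fun (f : nat -> nat) : Prop :=
  exists p : program, forall n, posnat n -> eval p [:: n] (f n).

Definition computable_coloring (c : nat -> bool) : Prop :=
  computable_fun (fun n => nat_of_bool (c n)).

Definition computable_set (X : set nat) : Prop :=
  computable_fun (fun n => nat_of_bool (n \in X)).

Definition FS_le (n : nat) (X : set nat) : set nat :=
  [set (\sum_(x <- F) x)%N |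
    F in [set F : {fset nat} | [set` F] `<=` X /\ 1 <= #|` F| <= n]].

Definition monochromatic (c : nat -> bool) (Z : set nat) : Prop :=
  forall x y, Z x -> Z y -> c x = c y.

(* Main.v *)
(** Write n = 3^v * m with m not divisible by 3, and let d(n) say whether m = 1
    mod 3. The coloring is c(n) = d(n) xor flip(v, n), where flip is a computable
    approximation which, for each fixed v, is eventually constant in n.

    If infinitely many elements of X have the same level v, take two large ones
    x, y with d(x) = d(y): then x + y has level v and d(x + y) <> d(x), so
    c(x + y) <> c(x).

    Otherwise X has elements of arbitrarily large level. Diagonalize: requirement
    e, which codes a program i and a color a, waits for an element x of the set
    decided by i whose level v is above the levels in use by the requirements
    before e, and then makes the limit of flip(v, n) equal to the truth value of
    [d(x) iff a = 1]. If X is decided by i, then for y in X of large size and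
    level, x + y has level v and d(x + y) = d(x), so c(x + y) is the color other
    than a.

    To make flip computable, evaluations of programs are witnessed by finite sets
    of triples (program, arguments, value), coded by the binary digits of a
    number, in which each triple follows from other triples of the set by one
    evaluation rule. *)

Require Import Defs.
From mathcomp Require Import all_boot finmap all_classical zify.

Set Implicit Arguments.
Unset Strict Implicit.
Unset Printing Implicit Defensive.

Local Open Scope classical_set_scope.

(** * Closure properties of the computable functions *)

(** Environments are padded with zeros to any length at least [k], so that no
    arities have to be tracked. *)
Definition recfun (F : seq nat -> nat) : Prop :=
  exists p k, forall j s, k <= j -> eval p (mkseq (nth 0 s) j) (F s).

Definition recpred (P : seq nat -> Prop) : Prop :=
  recfun (fun s => nat_of_bool `[< P s >]).

Lemma recfun_ext F G : F =1 G -> recfun F -> recfun G.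
Proof. by move=> FG [p [k Hp]]; exists p, k => j s kj; rewrite -FG; apply: Hp. Qed.

Lemma recpred_ext P Q : (forall s, P s <-> Q s) -> recpred P -> recpred Q.
Proof.
by move=> PQ; apply: recfun_ext => s; congr nat_of_bool; apply: asbool_equiv_eq.
Qed.

Lemma mkseq_nth_cons x s j :
  mkseq (nth 0 (x :: s)) j.+1 = x :: mkseq (nth 0 s) j.
Proof. by rewrite /mkseq /= -[1]/(1 + 0) iotaDl -map_comp. Qed.

Lemma recfun_var i : recfun (fun s => nth 0 s i).
Proof.
exists (Proj i), i.+1 => j s ij.
by rewrite -[nth 0 s i](nth_mkseq 0 _ ij); apply: eval_proj; rewrite size_mkseq.
Qed.

Fixpoint recfuns (Fs : seq (seq nat -> nat)) : Prop :=
  if Fs is F :: Fs' then recfun F /\ recfuns Fs' else True.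

Lemma recfuns_eval Fs : recfuns Fs -> exists qs k, size qs = size Fs /\
  forall j s i, k <= j -> i < size Fs ->
    eval (nth Zero qs i) (mkseq (nth 0 s) j) (nth 0 [seq F s | F <- Fs] i).
Proof.
elim: Fs => [_|F Fs IH [[p [k Hp]] /IH [qs [l [sq Hq]]]]]; first by exists [::], 0.
exists (p :: qs), (maxn k l); split=> [/=|j s [|i]]; first by rewrite sq.
  by rewrite geq_max => /andP[+ _] _; apply: Hp.
by rewrite geq_max => /andP[_ +]; apply: Hq.
Qed.

Lemma recfun_app G Fs :
  recfun G -> recfuns Fs -> recfun (fun s => G [seq F s | F <- Fs]).
Proof.
case=> p [k Hp] /recfuns_eval [qs [l [sq Hq]]].
(* The [k] extra programs [Zero] make the argument list long enough for [p]; their value 0 agrees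
   with the default read past the end of [t]. *)
exists (Comp p (qs ++ nseq k Zero)), l => j s lj.
pose t := [seq F s | F <- Fs].
have st : size t = size Fs by rewrite size_map.
apply: (@eval_comp _ _ _ (mkseq (nth 0 t) (size Fs + k))); last first.
- by apply: Hp; rewrite leq_addl.
- rewrite size_cat size_nseq sq => i il; rewrite nth_mkseq // nth_cat sq.
  case: ltnP => ifs; first exact: Hq.
  rewrite nth_nseq if_same nth_default ?st //; exact: eval_zero.
- by rewrite size_mkseq size_cat size_nseq sq.
Qed.

Lemma recfun_app1 g F : recfun (fun s => g (nth 0 s 0)) -> recfun F ->
  recfun (fun s => g (F s)).
Proof. by move=> Hg HF; apply: (recfun_app (Fs := [:: F]) Hg). Qed.

Lemma recfun_app2 g F1 F2 :
  recfun (fun s => g (nth 0 s 0) (nth 0 s 1)) -> recfun F1 -> recfun F2 ->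
  recfun (fun s => g (F1 s) (F2 s)).
Proof. by move=> Hg H1 H2; apply: (recfun_app (Fs := [:: F1; F2]) Hg). Qed.

Lemma recfun0 : recfun (fun=> 0).
Proof. exists Zero, 0 => j s _; exact: eval_zero. Qed.

Lemma recfunS F : recfun F -> recfun (fun s => (F s).+1).
Proof.
apply: recfun_app1; exists (Comp Succ [:: Proj 0]), 1 => -[//|j] s _.
apply: (@eval_comp _ _ _ [:: nth 0 s 0]) => //; last exact: eval_succ.
by case=> // _; apply: (eval_proj (i := 0)).
Qed.

Lemma recfun_const n : recfun (fun=> n).
Proof. by elim: n => [|n]; [exact: recfun0 | exact: recfunS]. Qed.

Lemma nth_iter_behead m i s : nth 0 (iter m behead s) i = nth 0 s (m + i).
Proof.
elim: m s => [//|m IH] s; rewrite addSn iterSr IH.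
by case: s => //=; rewrite !nth_nil.
Qed.

(** Variables act as de Bruijn indices: each bounded quantifier or recursion puts the outer ones
    under a further [behead]. *)
Lemma recfun_shift m i : recfun (fun s => nth 0 (iter m behead s) i).
Proof.
by apply: recfun_ext (recfun_var (m + i)) => s; rewrite nth_iter_behead.
Qed.

Lemma recfun_cons m F A : recfun F -> recfun A ->
  recfun (fun s => F (A s :: iter m behead s)).
Proof.
move=> [p [k Hp]] [a [l Ha]].
exists (Comp p (a :: mkseq (fun i => Proj (m + i)) k)), (maxn l (m + k)) => j s.
rewrite geq_max => /andP[lj kj].
apply: eval_comp (Hp k.+1 (A s :: iter m behead s) (leqnSn k)).
  by rewrite /= !size_map !size_iota.
rewrite mkseq_nth_cons; case=> [|i] /=; first by move=> _; apply: Ha.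
rewrite size_mkseq ltnS => ik; rewrite !nth_mkseq // nth_iter_behead.
have ij : m + i < j by apply: leq_trans kj; rewrite ltn_add2l.
by rewrite -[nth 0 s _](nth_mkseq 0 _ ij); apply: eval_proj; rewrite size_mkseq.
Qed.

Lemma recfun_rec A B N : recfun A ->
    recfun (fun s => B (nth 0 s 0) (nth 0 s 1) (behead (behead s))) ->
    recfun N ->
  recfun (fun s => nat_rect (fun=> nat) (A s) (fun n z => B n z s) (N s)).
Proof.
move=> [p [k Hp]] [q [l Hq]] HN.
suff H : recfun (fun s => nat_rect (fun=> nat) (A (behead s))
    (fun n z => B n z (behead s)) (nth 0 s 0)) by apply: (recfun_cons 0 H HN).
exists (Rec p q), (maxn k l).+1 => -[//|j] s; rewrite ltnS geq_max => /andP[kj lj].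
have -> : mkseq (nth 0 s) j.+1 = nth 0 s 0 :: mkseq (nth 0 (behead s)) j.
  rewrite -mkseq_nth_cons; case: s => // ; apply: eq_mkseq => -[|[|i]] //=.
elim: (nth 0 s 0) => [|n IH] /=; first by apply: eval_rec0; apply: Hp.
apply: (eval_recS IH); set z := nat_rect _ _ _ _.
rewrite -!mkseq_nth_cons; apply: (Hq j.+2 [:: n, z & behead s]).
exact: leq_trans lj (leq_trans (leqnSn _) (leqnSn _)).
Qed.

Ltac recfun_leaf :=
  first [ assumption | exact: recfun0 | exact: recfun_const
        | exact: (recfun_shift 0) | exact: (recfun_shift 1)
        | exact: (recfun_shift 2) | exact: (recfun_shift 3)
        | exact: (recfun_shift 4) | exact: (recfun_shift 5)
        | exact: (recfun_shift 6) ].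

Lemma recfunD F G : recfun F -> recfun G -> recfun (fun s => F s + G s).
Proof.
apply: (recfun_app2 (g := addn)).
apply: (recfun_ext (F := fun s => nat_rect (fun=> nat) (nth 0 s 0)
  (fun _ z => z.+1) (nth 0 s 1))).
  by move=> s; elim: (nth 0 s 1) => [|n /= ->]; rewrite ?addn0 ?addnS.
by apply: (recfun_rec (B := fun _ z _ => z.+1)); try apply: recfunS; recfun_leaf.
Qed.

Lemma recfunM F G : recfun F -> recfun G -> recfun (fun s => F s * G s).
Proof.
apply: (recfun_app2 (g := muln)).
apply: (recfun_ext (F := fun s => nat_rect (fun=> nat) 0
  (fun _ z => nth 0 s 0 + z) (nth 0 s 1))).
  by move=> s; elim: (nth 0 s 1) => [|n /= ->]; rewrite ?muln0 ?mulnS.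
by apply: (recfun_rec (B := fun _ z s => nth 0 s 0 + z)); try apply: recfunD; recfun_leaf.
Qed.

Lemma recfunX F G : recfun F -> recfun G -> recfun (fun s => F s ^ G s).
Proof.
apply: (recfun_app2 (g := expn)).
apply: (recfun_ext (F := fun s => nat_rect (fun=> nat) 1
  (fun _ z => nth 0 s 0 * z) (nth 0 s 1))).
  by move=> s; elim: (nth 0 s 1) => [|n /= ->]; rewrite ?expn0 ?expnS.
by apply: (recfun_rec (B := fun _ z s => nth 0 s 0 * z)); try apply: recfunM; recfun_leaf.
Qed.

Lemma recfun_pred F : recfun F -> recfun (fun s => (F s).-1).
Proof.
apply: (recfun_app1 (g := predn)).
apply: (recfun_ext (F := fun s => nat_rect (fun=> nat) 0
  (fun n _ => n) (nth 0 s 0))); first by move=> s; case: (nth 0 s 0).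
by apply: (recfun_rec (B := fun n _ _ => n)); recfun_leaf.
Qed.

Lemma recfunB F G : recfun F -> recfun G -> recfun (fun s => F s - G s).
Proof.
apply: (recfun_app2 (g := subn)).
apply: (recfun_ext (F := fun s => nat_rect (fun=> nat) (nth 0 s 0)
  (fun _ z => z.-1) (nth 0 s 1))).
  by move=> s; elim: (nth 0 s 1) => [|n /= ->]; rewrite ?subn0 ?subnS.
by apply: (recfun_rec (B := fun _ z _ => z.-1)); try apply: recfun_pred; recfun_leaf.
Qed.

Lemma recpred_leq F G : recfun F -> recfun G -> recpred (fun s => F s <= G s).
Proof.
move=> HF HG; have := recfunB (recfun_const 1) (recfunB HF HG).
apply: recfun_ext => s; rewrite asboolb /leq.
by case: (F s - G s).
Qed.

Lemma recpredN P : recpred P -> recpred (fun s => ~ P s).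
Proof.
move=> HP; have := recfunB (recfun_const 1) HP.
by apply: recfun_ext => s; rewrite asbool_neg; case: asboolP.
Qed.

Lemma recpred_and P Q : recpred P -> recpred Q -> recpred (fun s => P s /\ Q s).
Proof.
move=> HP HQ; have := recfunM HP HQ.
by apply: recfun_ext => s; rewrite asbool_and mulnb.
Qed.

Lemma recpred_or P Q : recpred P -> recpred Q -> recpred (fun s => P s \/ Q s).
Proof.
move=> HP HQ; have := recpredN (recpred_and (recpredN HP) (recpredN HQ)).
by apply: recpred_ext => s; rewrite not_andE !notK.
Qed.

Lemma recpred_imp P Q : recpred P -> recpred Q -> recpred (fun s => P s -> Q s).
Proof.
move=> HP HQ; have := recpred_or (recpredN HP) HQ.
by apply: recpred_ext => s; rewrite implyE.
Qed.

Lemma recpred_eq F G : recfun F -> recfun G -> recpred (fun s => F s = G s).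
Proof.
move=> HF HG; have := recpred_and (recpred_leq HF HG) (recpred_leq HG HF).
apply: recpred_ext => s; split=> [[a b]|->//]; apply/eqP; by rewrite eqn_leq a b.
Qed.

Lemma recfun_if P F G : recpred P -> recfun F -> recfun G ->
  recfun (fun s => if `[< P s >] then F s else G s).
Proof.
move=> HP HF HG; have := recfunD (recfunM HP HF) (recfunM (recpredN HP) HG).
by apply: recfun_ext => s; rewrite asbool_neg; case: asboolP; rewrite ?mul1n ?mul0n ?addn0.
Qed.

Lemma recpred_ex N P : recfun N ->
    recpred (fun s => P (nth 0 s 0) (behead s)) ->
  recpred (fun s => exists2 x, x < N s & P x s).
Proof.
(* The recursion step sees counter, accumulator and environment; dropping two entries and putting
   the counter back hides the accumulator from [P]. *)
move=> HN /(recfun_cons 2) /(_ (recfun_var 0)) /= HP.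
apply: (recfun_ext (F := fun s => nat_rect (fun=> nat) 0
  (fun n z => if `[< P n s >] then 1 else z) (N s))); last first.
  apply: (recfun_rec (B := fun n z s => if `[< P n s >] then 1 else z)) => //;
    last apply: recfun_if; recfun_leaf.
move=> s; elim: (N s) => [|n /= ->].
  by case: asboolP => // -[].
case: (asboolP (P n s)) => Pn.
  by case: asboolP => // -[]; exists n.
congr nat_of_bool; apply: asbool_equiv_eq; split=> -[x xn Px].
  by exists x => //; apply: ltnW.
exists x => //; move: xn; rewrite ltnS leq_eqVlt => /predU1P[xE|//].
by move: Pn; rewrite -xE.
Qed.

Lemma recpred_all N P : recfun N ->
    recpred (fun s => P (nth 0 s 0) (behead s)) ->
  recpred (fun s => forall x, x < N s -> P x s).
Proof.
move=> HN HP.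
have := recpredN (recpred_ex (P := fun x s => ~ P x s) HN (recpredN HP)).
apply: recpred_ext => s; split=> [H x xN|H [x xN]]; last by apply; apply: H.
by apply: contrapT => Px; apply: H; exists x.
Qed.

(** The accumulator is the result of the search below [n]. It equals [n] as long as nothing has been
    found, hence the test [z < n]. *)
Lemma recfun_find N P : recfun N ->
    recpred (fun s => P (nth 0 s 0) (behead s)) ->
  recfun (fun s => find (fun x => `[< P x s >]) (iota 0 (N s))).
Proof.
move=> HN /(recfun_cons 2) /(_ (recfun_var 0)) /= HP.
apply: (recfun_ext (F := fun s => nat_rect (fun=> nat) 0
  (fun n z => if `[< z < n >] then z else if `[< P n s >] then n else n.+1) (N s)));
  last first.
  apply: (recfun_rec (B := fun n z s => if `[< z < n >] then z
    else if `[< P n s >] then n else n.+1)); try recfun_leaf.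
  apply: recfun_if; [|recfun_leaf|].
    by apply: recpred_leq; try apply: recfunS; recfun_leaf.
  by apply: recfun_if; try apply: recfunS; recfun_leaf.
move=> s; elim: (N s) => [//|n IH]; rewrite [LHS]/= IH asboolb.
rewrite -[in iota 0 n.+1]addn1 iotaD find_cat has_find size_iota /= add0n.
case: ltnP => // _; case: asboolP; by rewrite ?addn0 ?addn1.
Qed.

(** * Certificates of evaluation *)

Definition pr (a b : nat) : nat := (a + b) * (a + b) + a.

(** [pr a b] is at least the square of [a + b] and less than the next square, so it determines
    [a + b], and then [a]. *)
Lemma pr_inj a b c d : pr a b = pr c d -> a = c /\ b = d.
Proof. rewrite /pr => H; have : a + b = c + d by nia. by move: H; nia. Qed.

Lemma leq_prl a b : a <= pr a b. Proof. by rewrite leq_addl. Qed.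

Lemma leq_prr a b : b <= pr a b. Proof. rewrite /pr; nia. Qed.

Definition bit (w k : nat) : bool := odd (w %/ 2 ^ k).

Lemma bit_lt w k : bit w k -> k < w.
Proof.
rewrite /bit; case: (ltnP w (2 ^ k)) => [/divn_small->//|kw _].
by apply: leq_trans kw; apply: ltn_expl.
Qed.

(** This form has only arithmetic and bounded quantifiers, so the closure properties apply to it. *)
Lemma bitE w k : bit w k <-> exists2 q, q < w.+1 &
  exists2 r, r < 2 ^ k & w = (q + q).+1 * 2 ^ k + r.
Proof.
have k0 : 0 < 2 ^ k by rewrite expn_gt0.
split=> [o|[q _ [r rk ->]]].
  have := odd_double_half (w %/ 2 ^ k); rewrite -/(bit w k) o -addnn add1n => E.
  have qw : w %/ 2 ^ k <= w by apply: leq_div.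
  exists ((w %/ 2 ^ k)./2); first by lia.
  by exists (w %% 2 ^ k); [rewrite ltn_mod | rewrite E -divn_eq].
by rewrite /bit divnMDl // divn_small // addn0 /= oddD addbb.
Qed.

Lemma bits_exist (P : pred nat) N : exists w, forall k, bit w k = (k < N) && P k.
Proof.
(* The bound on [w] keeps position [N] free for the next digit. *)
suff [w [_ Hw]] : exists w, w < 2 ^ N /\ forall k, bit w k = (k < N) && P k.
  by exists w.
elim: N => [|N [w [wN Hw]]]; first by exists 0; split=> // k; rewrite /bit div0n.
have wN' : P N * 2 ^ N + w < 2 ^ N.+1.
  by rewrite expnS mul2n -addnn -addnS leq_add //; case: (P N); rewrite ?mul1n.
exists (P N * 2 ^ N + w); split=> // k; case: (ltngtP k N) => [kN|Nk|->].
- have -> : 2 ^ N = 2 ^ (N - k).-1 * 2 * 2 ^ k.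
    by rewrite -expnSr prednK ?subn_gt0 // -expnD subnK // ltnW.
  rewrite mulnA /bit divnMDl ?expn_gt0 // oddD !oddM !andbF -/(bit w k) Hw kN.
  by rewrite ltnS ltnW.
- by rewrite ltnS leqNgt Nk /bit divn_small // (leq_trans wN') // leq_pexp2l.
- by rewrite ltnSn /bit divnMDl ?expn_gt0 // divn_small // addn0; case: (P N).
Qed.

Definition listed w e x y : Prop := bit w (pr e (pr x y)).

Lemma listed_lt w e x y : listed w e x y -> [/\ e < w, x < w & y < w].
Proof.
move=> /bit_lt; have := leq_prl e (pr x y); have := leq_prr e (pr x y).
have := leq_prl x y; have := leq_prr x y; split; lia.
Qed.

(** Codes of programs in a language of unary functions: an argument list is coded
    by nested pairs, so that no arities occur. *)
Definition cZero := pr 0 0.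
Definition cSucc := pr 1 0.
Definition cFst := pr 2 0.
Definition cSnd := pr 3 0.
Definition cComp f g := pr 4 (pr f g).
Definition cPair f g := pr 5 (pr f g).
Definition cRec f g := pr 6 (pr f g).
Definition cMu f := pr 7 f.

(** [M e x y] reads: the program with code [e] maps the code [x] to [y]. The bound
    [n] on the quantifiers makes the relation decidable. *)
Definition justified n (M : nat -> nat -> nat -> Prop) e x y : Prop :=
  exists2 f, f < n & exists2 g, g < n & exists2 a, a < n & exists2 b, b < n &
  (e = cZero /\ y = 0) \/
  (e = cSucc /\ (x = pr a b /\ y = a.+1)) \/
  (e = cFst /\ x = pr y b) \/
  (e = cSnd /\ x = pr a y) \/
  (e = cComp f g /\ (M g x a /\ M f a y)) \/
  (e = cPair f g /\ (M f x a /\ (M g x b /\ y = pr a b))) \/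
  (e = cRec f g /\ (x = pr 0 b /\ M f b y)) \/
  (e = cRec f g /\ (x = pr a.+1 b /\
     exists2 z, z < n & M e (pr a b) z /\ M g (pr a (pr z b)) y)) \/
  (e = cMu f /\ (M f (pr y x) 0 /\
     forall z, z < y -> exists2 v, v < n & M f (pr z x) v.+1)).

Definition all_justified n w : Prop := forall e, e < n -> forall x, x < n ->
  forall y, y < n -> listed w e x y -> justified n (listed w) e x y.

(** The entries of listed triples are below [w], so [w <= n] lets the bounded quantifiers of
    [all_justified] reach every listed triple. *)
Definition certificate n w : Prop := w <= n /\ all_justified n w.

Definition derivable e x y := exists n w, certificate n w /\ listed w e x y.

(** The rules use [M] only positively, and [n] bounds only existential quantifiers; the one
    universal quantifier is bounded by [y]. *)
Lemma justified_sub n n' M M' e x y : n <= n' ->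
  (forall e x y, M e x y -> M' e x y) -> justified n M e x y -> justified n' M' e x y.
Proof.
move=> nn' MM' [f fn [g gn [a an [b bn H]]]].
exists f; [exact: leq_trans nn'|exists g; [exact: leq_trans nn'|]].
exists a; [exact: leq_trans nn'|exists b; [exact: leq_trans nn'|]].
case: H => [|[|[|[|[|[|[|[|]]]]]]]].
- by left.
- by right; left.
- by do 2!right; left.
- by do 3!right; left.
- by move=> [-> [/MM' ? /MM' ?]]; do 4!right; left.
- by move=> [-> [/MM' ? [/MM' ? ->]]]; do 5!right; left.
- by move=> [-> [-> /MM' ?]]; do 6!right; left.
- move=> [-> [-> [z zn [/MM' ? /MM' ?]]]]; do 7!right; left; split=> //; split=> //.
  by exists z => //; apply: leq_trans nn'.
move=> [-> [/MM' ? H]]; do 8!right; split=> //; split=> // z /H [v vn /MM' ?].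
by exists v => //; apply: leq_trans nn'.
Qed.

Lemma certificate_justified n w e x y :
  certificate n w -> listed w e x y -> justified n (listed w) e x y.
Proof.
move=> [wn Hw] Mw; have [ew xw yw] := listed_lt Mw.
by apply: Hw => //; apply: leq_trans wn.
Qed.

Lemma certificate_leq n n' w : n <= n' -> certificate n w -> certificate n' w.
Proof.
move=> nn' c; split=> [|e _ x _ y _ Mw]; first exact: leq_trans c.1 nn'.
exact: justified_sub nn' _ (certificate_justified c Mw).
Qed.

(** The union of the two sets works, since a triple stays justified in a larger set. *)
Lemma certificate_join n1 w1 n2 w2 : certificate n1 w1 -> certificate n2 w2 ->
  exists n w, certificate n w /\
    forall e x y, listed w1 e x y \/ listed w2 e x y -> listed w e x y.
Proof.
move=> c1 c2; have [w Hw] := bits_exist (fun k => bit w1 k || bit w2 k) (maxn w1 w2).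
have memw e x y : listed w e x y <-> listed w1 e x y \/ listed w2 e x y.
  rewrite /listed Hw; split=> [/andP[_ /orP]//|H]; apply/andP; split; last exact/orP.
  by case: H => /bit_lt; rewrite leq_max => ->; rewrite ?orbT.
exists (n1 + n2 + w), w; split=> [|e x y /memw//].
split=> [|e _ x _ y _ /memw]; first exact: leq_addl.
by case=> [/(certificate_justified c1)|/(certificate_justified c2)]; apply: justified_sub;
  rewrite -?addnA ?leq_addr 1?addnCA ?leq_addr // => *; apply/memw; [left|right].
Qed.

Lemma certificate_add n w m e x y : certificate n w ->
  justified m (listed w) e x y -> derivable e x y.
Proof.
move=> c J; pose k := pr e (pr x y).
have [w' Hw] := bits_exist (fun i => bit w i || (i == k)) (maxn w k.+1).
have sub e' x' y' : listed w e' x' y' -> listed w' e' x' y'.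
  by rewrite /listed Hw => b; rewrite b leq_max (bit_lt b).
exists (n + m + w'), w'; split; last by rewrite /listed Hw eqxx orbT leq_max ltnSn orbT.
split=> [|e' _ x' _ y' _]; first exact: leq_addl.
rewrite /listed Hw => /andP[_ /orP[/(certificate_justified c)|]].
  by apply: justified_sub => //; rewrite -addnA leq_addr.
move=> /eqP/pr_inj[-> /pr_inj[-> ->]].
by apply: justified_sub J => //; rewrite -addnA addnCA leq_addr.
Qed.

Lemma certificate0 : certificate 0 0.
Proof. by split. Qed.

Fixpoint proj_code i := if i is j.+1 then cComp (proj_code j) cSnd else cFst.

(** In [Comp], the inner programs become one function that builds the list of their values by
    pairing; it ends in [cZero], whose value 0 codes the empty list. *)
Fixpoint code (p : program) : nat :=
  match p with
  | Zero => cZero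
  | Succ => cSucc
  | Proj i => proj_code i
  | Comp p qs => cComp (code p) (foldr (fun q c => cPair (code q) c) cZero qs)
  | Rec p q => cRec (code p) (code q)
  | Mu p => cMu (code p)
  end.

Definition list_code (s : seq nat) : nat := foldr pr 0 s.

(** The first components of codes tell the constructors apart, so [pr_inj] refutes all rules for
    other constructors. *)
Ltac justified_inv :=
  case=> [? _ [? _ [? _ [? _]]]];
  repeat (case; [try by case=> /pr_inj[] | ]);
  try by case=> /pr_inj[].

(** A certificate carries no order on its triples. It cannot be circular, since
    every rule refers to subprograms or to a smaller recursion argument. *)
Lemma certificate_sound n w p s y : certificate n w -> eval p s y ->
  forall y', listed w (code p) (list_code s) y' -> y' = y.
Proof.
move=> c; elim=> {p s y}.
- by move=> s y' /(certificate_justified c); justified_inv.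
- move=> x y' /(certificate_justified c); justified_inv.
  by case=> _ [/pr_inj[<- _] ->].
- elim=> [|i IH] [//|x s] si y' /(certificate_justified c); justified_inv.
    by case=> _ /pr_inj[].
  case=> /pr_inj[_ /pr_inj[<- <-]] [/(certificate_justified c)]; justified_inv.
  case=> _ /pr_inj[_ <-]; exact: IH.
- move=> p qs s zs y sz _ IHq _ IHp y' /(certificate_justified c); justified_inv.
  case=> /pr_inj[_ /pr_inj[<- <-]] [].
  suff Hqs : forall a,
      listed w (foldr (fun q c => cPair (code q) c) cZero qs) (list_code s) a ->
     a = list_code zs by move=> /Hqs ->; apply: IHp.
  elim: qs zs sz IHq {IHp} => [|q qs IH] [|z zs] //= sz IHq .
    by move=> d /(certificate_justified c); justified_inv.
  move=> d /(certificate_justified c); justified_inv.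
  case=> /pr_inj[_ /pr_inj[<- <-]] [Mq [Mqs ->]]; congr pr.
    exact: (IHq 0).
  apply: IH Mqs; first by case: sz.
  by move=> i; apply: (IHq i.+1).
- move=> p q s y _ IH y' /(certificate_justified c); justified_inv.
    by case=> /pr_inj[_ /pr_inj[<- _]] [/pr_inj[_ <-]]; apply: IH.
  by case=> _ [/pr_inj[]].
- move=> p q n' s z y _ IHp _ IHq y' /(certificate_justified c); justified_inv.
    by case=> _ [/pr_inj[]].
  case=> /pr_inj[_ /pr_inj[_ <-]] [/pr_inj[[<-] <-]] [z' _ [/IHp -> ]].
  exact: IHq.
- move=> p s v y _ IHv _ IH y' /(certificate_justified c); justified_inv.
  case=> /pr_inj[_ <-] [M0 MS].
  (* If [y' < y], the certificate lists value 0 where [p] is positive; if [y < y'], it lists a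
     positive value at the zero [y] of [p]. *)
  case: (ltngtP y' y) => // [lt|/MS [v' _ /IH//]].
  by have := IHv _ lt _ M0.
Qed.

(** By induction on the evaluation: the certificates of the premises are joined and the conclusion
    is added. The bound [m] only has to exceed the witnesses of the rule. *)
Lemma derivable_complete p s y : eval p s y -> derivable (code p) (list_code s) y.
Proof.
elim=> {p s y}.
- move=> s; apply: (certificate_add (m := 1) certificate0).
  by do 4!exists 0 => //; left.
- move=> x; apply: (certificate_add (m := x.+1) certificate0).
  exists 0 => //; exists 0 => //; exists x => //; exists 0 => //.
  by right; left.
- elim=> [|i IH] [//|x s] si.
    apply: (certificate_add (m := (list_code s).+1) certificate0).
    do 3!exists 0 => //; exists (list_code s) => //.
    by do 2!right; left.
  have [n1 [w1 [c1 M1]]] := IH s si.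
  have [n2 [w2 [c2 M2]]] : derivable cSnd (list_code (x :: s)) (list_code s).
    apply: (certificate_add (m := x.+1) certificate0).
    do 2!exists 0 => //; exists x => //; exists 0 => //.
    by do 3!right; left.
  have [n [w [c Mw]]] := certificate_join c1 c2.
  pose m := proj_code i + cSnd + list_code s.
  apply: (certificate_add (m := m.+1) c).
  exists (proj_code i); first lia; exists cSnd; first lia.
  exists (list_code s); first lia; exists 0; first lia.
  do 4!right; left; split=> //; split; apply: Mw; by [right|left].
- move=> p qs s zs y sz _ IHq _ [n1 [w1 [c1 M1]]].
  have [n2 [w2 [c2 M2]]] : derivable
      (foldr (fun q c => cPair (code q) c) cZero qs) (list_code s) (list_code zs).
    elim: qs zs sz IHq {M1} => [|q qs IH] [|z zs] //= sz IHq.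
      apply: (certificate_add (m := 1) certificate0).
      by do 4!exists 0 => //; left.
    have [n3 [w3 [c3 M3]]] := IHq 0 isT.
    have [n4 [w4 [c4 M4]]] := IH zs (succn_inj sz) (fun i => IHq i.+1).
    have [n [w [c Mw]]] := certificate_join c3 c4.
    set g := foldr _ _ _ in M4 *.
    apply: (certificate_add (m := (code q + g + z + list_code zs).+1) c).
    exists (code q); first lia; exists g; first lia.
    exists z; first lia; exists (list_code zs); first lia.
    do 5!right; left; split=> //; split; first by apply: Mw; left.
    by split=> //; apply: Mw; right.
  have [n [w [c Mw]]] := certificate_join c1 c2.
  set g := foldr _ _ _ in M2 *.
  apply: (certificate_add (m := (code p + g + list_code zs).+1) c).
  exists (code p); first lia; exists g; first lia.
  exists (list_code zs); first lia; exists 0; first lia.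
  do 4!right; left; split=> //; split; apply: Mw; by [right|left].
- move=> p q s y _ [n [w [c Mw]]].
  apply: (certificate_add (m := (code p + code q + list_code s).+1) c).
  exists (code p); first lia; exists (code q); first lia.
  exists 0; first lia; exists (list_code s); first lia.
  by do 6!right; left.
- move=> p q m s z y _ [n1 [w1 [c1 M1]]] _ [n2 [w2 [c2 M2]]].
  have [n [w [c Mw]]] := certificate_join c1 c2.
  apply: (certificate_add (m := (code p + code q + m + list_code s + z).+1) c).
  exists (code p); first lia; exists (code q); first lia.
  exists m; first lia; exists (list_code s); first lia.
  do 7!right; left; split=> //; split=> //; exists z; first lia.
  by split; apply: Mw; [left|right].
move=> p s v y _ IHv _ [n1 [w1 [c1 M1]]].
(* The certificates for all points below [y] are merged one by one into a single one, with a common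
   bound [m] on the values. *)
have [n2 [w2 [c2 [m M2]]]] : exists n w, certificate n w /\ exists m, forall z, z < y ->
    exists2 u, u < m & listed w (code p) (pr z (list_code s)) u.+1.
  elim: y IHv {M1} => [|y IH] IHv.
    by exists 0, 0; split; [exact: certificate0 | exists 0].
  have [z zy|n3 [w3 [c3 [m M3]]]] := IH; first by apply: IHv; apply: ltnW.
  have [n4 [w4 [c4 M4]]] := IHv y (ltnSn y).
  have [n [w [c Mw]]] := certificate_join c3 c4.
  exists n, w; split=> //; exists (m + v y).+1 => z.
  rewrite ltnS leq_eqVlt => /predU1P[->|/M3 [u um Mu]].
    by exists (v y); [lia | apply: Mw; right].
  by exists u; [lia | apply: Mw; left].
have [n [w [c Mw]]] := certificate_join c1 c2.
apply: (certificate_add (m := (code p + m).+1) c).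
exists (code p); first lia; do 3!(exists 0; first lia).
do 8!right; split=> //; split=> [|z /M2 [u um Mu]]; first by apply: Mw; left.
by exists u; [lia | apply: Mw; right].
Qed.

(** * Decidability of certificates *)

Lemma recfun_pr F G : recfun F -> recfun G -> recfun (fun s => pr (F s) (G s)).
Proof. by move=> HF HG; apply: recfunD => //; apply: recfunM; apply: recfunD. Qed.

Ltac rec_step :=
  match goal with
  | |- recpred (fun s => @?A s /\ @?B s) => apply: recpred_and
  | |- recpred (fun s => @?A s \/ @?B s) => apply: recpred_or
  | |- recpred (fun s => @?A s = @?B s) => apply: recpred_eq
  | |- recpred (fun s => ex2 (@?A s) (@?B s)) => apply: recpred_ex
  | |- recpred (fun s => is_true (leq (@?A s) (@?B s))) => apply: recpred_leq
  | |- recpred (fun s => forall x, is_true (leq x.+1 (@?A s)) -> @?B s x) =>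
      apply: recpred_all
  | |- recfun (fun s => S (@?A s)) => apply: recfunS
  | |- recfun (fun s => addn (@?A s) (@?B s)) => apply: recfunD
  | |- recfun (fun s => muln (@?A s) (@?B s)) => apply: recfunM
  | |- recfun (fun s => expn (@?A s) (@?B s)) => apply: recfunX
  | |- recfun (fun s => pr (@?A s) (@?B s)) => apply: recfun_pr
  end.

Ltac recursive := repeat (cbv beta; first [recfun_leaf | rec_step]).

Lemma recpred_bit F G : recfun F -> recfun G -> recpred (fun s => bit (F s) (G s)).
Proof.
apply: (recfun_app2 (g := fun w k => nat_of_bool `[< bit w k >])).
by apply: recpred_ext => [s|]; [symmetry; apply: bitE | recursive].
Qed.

Lemma recpred_listed F G H K : recfun F -> recfun G -> recfun H -> recfun K ->
  recpred (fun s => listed (F s) (G s) (H s) (K s)).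
Proof. by move=> *; apply: recpred_bit; recursive. Qed.

Lemma recpred_justified N W E X Y :
    recfun N -> recfun W -> recfun E -> recfun X -> recfun Y ->
  recpred (fun s => justified (N s) (listed (W s)) (E s) (X s) (Y s)).
Proof.
move=> HN HW HE HX HY.
(* The parameters are first replaced by variables: under a quantifier a variable is merely shifted,
   whereas an arbitrary [W] would get composed with [behead]. *)
apply: (recfun_app
  (G := fun s => nat_of_bool `[< justified (nth 0 s 0) (listed (nth 0 s 1))
   (nth 0 s 2) (nth 0 s 3) (nth 0 s 4) >]) (Fs := [:: N; W; E; X; Y])) => //.
rewrite -/(recpred _) /justified /cZero /cSucc /cFst /cSnd /cComp /cPair /cRec /cMu.
by recursive; apply: recpred_listed; recursive.
Qed.

Lemma recpred_certificate N W : recfun N -> recfun W ->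
  recpred (fun s => certificate (N s) (W s)).
Proof.
apply: (recfun_app2 (g := fun n w => nat_of_bool `[< certificate n w >])).
rewrite -/(recpred _) /certificate /all_justified; apply: recpred_and; first by recursive.
recursive; apply: recpred_imp; first by apply: recpred_listed; recursive.
by apply: recpred_justified; recursive.
Qed.

(** * The coloring *)

Definition low_digit1 n : bool := n %/ 3 ^ logn 3 n %% 3 == 1.

(** The digit is written [d.+1] with [d < 2], which excludes the digit 0. *)
Lemma ternary_spec v q d : d < 2 -> let n := 3 ^ v * (q * 3 + d.+1) in
  logn 3 n = v /\ low_digit1 n = (d == 0).
Proof.
move=> d2 n; have m0 : 0 < q * 3 + d.+1 by rewrite addnS.
have nd : ~~ (3 %| q * 3 + d.+1).
  by rewrite dvdn_addr ?dvdn_mull //; case: d d2 {n m0} => [|[]].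
have L : logn 3 n = v.
  by rewrite lognM ?expn_gt0 // pfactorK // [logn 3 (_ + _)]lognE /= m0 (negbTE nd) addn0.
split=> //; rewrite /low_digit1 L mulKn ?expn_gt0 // modnMDl.
by case: d d2 {n m0 nd L} => [|[]].
Qed.

Lemma ternary_ex n : 0 < n -> exists q d, d < 2 /\
  [/\ n = 3 ^ logn 3 n * (q * 3 + d.+1) & low_digit1 n = (d == 0)].
Proof.
move=> n0; pose m := n %/ 3 ^ logn 3 n.
have nE : n = 3 ^ logn 3 n * m by rewrite mulnC divnK // pfactor_dvdnn.
have m3 : m %% 3 != 0.
  apply/negP => /eqP m3; have : 3 ^ (logn 3 n).+1 %| n.
    by rewrite {2}nE expnSr dvdn_pmul2l ?expn_gt0 // /dvdn m3.
  by rewrite pfactor_dvdn // ltnn.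
have := ltn_pmod m (isT : 0 < 3); have := divn_eq m 3; rewrite /low_digit1 -/m.
case: (m %% 3) m3 => [//|d] _ mE d2; exists (m %/ 3), d; split=> //.
by split=> //; rewrite -mE.
Qed.

Lemma low_digit1P n : 0 < n ->
  low_digit1 n <-> exists2 q, q < n.+1 & n = 3 ^ logn 3 n * (q * 3 + 1).
Proof.
move=> n0; split=> [|[q _ nE]]; last first.
  by have [_] := ternary_spec (logn 3 n) q (isT : 0 < 2); rewrite -nE.
have [q [[|d] [d2 [nE ->]]]] := ternary_ex n0 => // _.
exists q => //; have : 0 < 3 ^ logn 3 n by rewrite expn_gt0.
by move: (3 ^ _) nE => k; nia.
Qed.

(** The lowest nonzero digit of [x] stands where [y] has a zero, and all digits of [y] below it are
    zero. *)
Lemma add_logn_lt x y : 0 < x -> 0 < y -> logn 3 x < logn 3 y ->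
  logn 3 (x + y) = logn 3 x /\ low_digit1 (x + y) = low_digit1 x.
Proof.
move=> x0 y0 xy; have [q [d [d2 [xE ->]]]] := ternary_ex x0.
have [q' [d' [_ [yE _]]]] := ternary_ex y0.
pose m := 3 ^ (logn 3 y - (logn 3 x).+1) * (q' * 3 + d'.+1).
have -> : x + y = 3 ^ logn 3 x * ((q + m) * 3 + d.+1).
  rewrite {1}xE {1}yE -{1}(subnKC xy) expnD expnSr /m; nia.
exact: ternary_spec.
Qed.

(** Modulo 3, doubling a nonzero digit exchanges 1 and 2; for the digit 2 there is a carry, whence
    [(q + q').+1]. *)
Lemma add_logn_eq x y : 0 < x -> 0 < y -> logn 3 x = logn 3 y ->
  low_digit1 x = low_digit1 y ->
  logn 3 (x + y) = logn 3 x /\ low_digit1 (x + y) = ~~ low_digit1 x.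
Proof.
move=> x0 y0 xy; have [q [d [d2 [xE ->]]]] := ternary_ex x0.
have [q' [d' [d2' [yE ->]]]] := ternary_ex y0.
rewrite -xy in yE; case: d d2 xE => [|[]] // _ xE; case: d' d2' yE => [|[]] // _ yE _.
  have -> : x + y = 3 ^ logn 3 x * ((q + q') * 3 + 2) by rewrite {1}xE {1}yE; nia.
  exact: ternary_spec.
have -> : x + y = 3 ^ logn 3 x * ((q + q').+1 * 3 + 1) by rewrite {1}xE {1}yE; nia.
exact: (ternary_spec _ _ (isT : 0 < 2)).
Qed.

Lemma find_iota (P : pred nat) x n : x < n -> P x -> (forall y, P y -> x <= y) ->
  find P (iota 0 n) = x.
Proof.
move=> xn Px min; have hP : has P (iota 0 n).
  by apply/hasP; exists x => //; rewrite mem_iota.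
have fn : find P (iota 0 n) < n by have := hP; rewrite has_find size_iota.
apply/eqP; rewrite eqn_leq; apply/andP; split; last first.
  by apply: min; have := nth_find 0 hP; rewrite nth_iota.
by rewrite leqNgt; apply/negP => /(before_find 0); rewrite nth_iota // add0n Px.
Qed.

Lemma recfun_logn3 F : recfun F -> recfun (fun s => logn 3 (F s)).
Proof.
apply: (recfun_app1 (g := logn 3)).
(* The level of a positive number is below the number itself, which bounds the search. At 0 the
   empty search returns 0, the value of [logn 3 0]. *)
apply: (recfun_ext (F := fun s => find (fun v => `[< exists2 q, q < (nth 0 s 0).+1 &
   nth 0 s 0 = 3 ^ v * (q * 3 + 1) \/ nth 0 s 0 = 3 ^ v * (q * 3 + 2) >])
   (iota 0 (nth 0 s 0)))); last first.
  apply: (recfun_find (P := fun v s => exists2 q, q < (nth 0 s 0).+1 &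
   nth 0 s 0 = 3 ^ v * (q * 3 + 1) \/ nth 0 s 0 = 3 ^ v * (q * 3 + 2))).
    by recursive.
  by recursive.
move=> s; case: (posnP (nth 0 s 0)) => [->|]; first by [].
move: (nth 0 s 0) => n n0; apply: find_iota.
- by rewrite (leq_trans (ltn_expl (logn 3 n) (isT : 1 < 3))) // dvdn_leq // pfactor_dvdnn.
- have [q [d [d2 [nE _]]]] := ternary_ex n0; apply/asboolP; exists q.
    have : 0 < 3 ^ logn 3 n by rewrite expn_gt0.
    by move: (3 ^ _) nE => k; nia.
  by case: d d2 nE => [|[]] // _ nE; [left|right].
move=> v /asboolP [q _ []] ->.
  by have [-> _] := ternary_spec v q (isT : 0 < 2).
by have [-> _] := ternary_spec v q (isT : 1 < 2).
Qed.

(** At stage [n], the program with code [i] is seen to accept [x]. *)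
Definition enumerated i x n : Prop :=
  exists2 w, w < n.+1 & certificate n w /\ listed w i (pr x 0) 1.

(** The bounds on [i] and [a] lose nothing, because [pr] dominates both its arguments. *)
Definition candidate e r n x : Prop :=
  0 < x /\ (r <= logn 3 x /\
  exists2 i, i < e.+1 & exists2 a, a < e.+1 & e = pr i a /\ enumerated i x n).

(** Junk value: [n] if there is no candidate below [n]. *)
Definition least n e r : nat := find (fun x => `[< candidate e r n x >]) (iota 0 n).

(** At stage [n], the first level that no requirement before [e] occupies. *)
Definition restraint n e : nat :=
  nat_rect (fun=> nat) 0 (fun e r =>
    if `[< least n e r < n >] then (logn 3 (least n e r)).+1 else r.+1) e.

Definition witness n e : nat := least n e (restraint n e).

(** The bounded existential says that the color coded in [e] is 1. *)
Definition flips v n e : Prop :=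
  witness n e < n /\ (logn 3 (witness n e) = v /\
  (low_digit1 (witness n e) <-> exists2 i, i < e.+1 & e = pr i 1)).

(** No requirement is missed: by [restraint_geq] a witness of requirement [e] has level at least
    [e]. *)
Definition flipped v n : Prop := exists2 e, e < v.+1 & flips v n e.

Definition color n : bool := low_digit1 n (+) `[< flipped (logn 3 n) n >].

(** * Convergence of the approximations *)

Lemma enumerated_leq i x n n' : n <= n' -> enumerated i x n -> enumerated i x n'.
Proof.
move=> nn' [w wn [c l]]; exists w; first exact: leq_trans wn _.
by split=> //; apply: certificate_leq c.
Qed.

Lemma candidate_leq e r n n' x : n <= n' -> candidate e r n x -> candidate e r n' x.
Proof.
move=> nn' [x0 [rx [i ie [a ae [E H]]]]]; do 2!split=> //.
by exists i => //; exists a => //; split=> //; apply: enumerated_leq H.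
Qed.

(** Candidates persist as [n] grows, so the least number that ever becomes a candidate is the limit
    once it has appeared and lies below [n]. *)
Lemma least_lim e r :
  (exists x N, candidate e r N x /\ forall n, N <= n -> x < n /\ least n e r = x) \/
  (forall n x, ~ candidate e r n x).
Proof.
have [[n [x c]]|H] := pselect (exists n x, candidate e r n x); last first.
  by right=> n x c; apply: H; exists n, x.
left; have ex : exists x, `[< exists n, candidate e r n x >].
  by exists x; apply/asboolP; exists n.
case: (ex_minnP ex) => {c}x {n}/asboolP[N c] min.
exists x, (N + x.+1); split; first by apply: candidate_leq c; apply: leq_addr.
move=> n Nn; have xn : x < n by apply: leq_trans Nn; apply: leq_addl.
split=> //; apply: find_iota => //.
  by apply/asboolP; apply: candidate_leq c; apply: leq_trans Nn; apply: leq_addr.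
by move=> y /asboolP cy; apply: min; apply/asboolP; exists n.
Qed.

Lemma least_none e r n : (forall n x, ~ candidate e r n x) -> least n e r = n.
Proof.
move=> H; rewrite /least hasNfind ?size_iota //.
by apply/hasPn => x _; apply/asboolP.
Qed.

(** Once the restraint on [e] has settled, [least_lim] settles the witness of [e], and with it the
    next restraint. *)
Lemma restraint_lim e : exists r N, forall n, N <= n -> restraint n e = r.
Proof.
elim: e => [|e [r [N IH]]]; first by exists 0, 0.
have [[x [N' [_ H]]]|H] := least_lim e r.
  exists (logn 3 x).+1, (N + N') => n Nn /=; rewrite -/(restraint n e) IH; last lia.
  by have [xn ->] := H n ltac:(lia); rewrite asboolT.
exists r.+1, N => n Nn /=; rewrite -/(restraint n e) IH // least_none //.
by rewrite asboolF // ltnn.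
Qed.

Lemma least_candidate n e r : least n e r < n -> candidate e r n (least n e r).
Proof.
move=> H; have hP : has (fun x => `[< candidate e r n x >]) (iota 0 n).
  by rewrite has_find size_iota.
by have /asboolP := nth_find 0 hP; rewrite nth_iota.
Qed.

(** A witness has level at least the current restraint; without a witness the branch [r.+1] still
    gives a strict increase. *)
Lemma restraint_lt n e : restraint n e < restraint n e.+1.
Proof.
rewrite /= -/(restraint n e); case: asboolP => // /least_candidate [_ []].
by rewrite ltnS.
Qed.

Lemma restraint_witness n e e' : witness n e < n -> e < e' ->
  logn 3 (witness n e) < restraint n e'.
Proof.
move=> wn; elim: e' => // e' IH; rewrite ltnS leq_eqVlt => /predU1P[<-|/IH].
  by rewrite /= -/(restraint n e) -/(witness n e) asboolT.
by move=> H; apply: ltn_trans H (restraint_lt _ _).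
Qed.

(** At each stage a level is controlled by at most one requirement, since the later of two must
    respect a restraint above the level of the earlier. *)
Lemma witness_inj n e e' : witness n e < n -> witness n e' < n ->
  logn 3 (witness n e) = logn 3 (witness n e') -> e = e'.
Proof.
move=> w w' E; have [_ [r _]] := least_candidate w; have [_ [r' _]] := least_candidate w'.
case: (ltngtP e e') => // [/(restraint_witness w)|/(restraint_witness w')].
  by rewrite E ltnNge -/(witness n e') r'.
by rewrite -E ltnNge r.
Qed.

Lemma restraint_geq n e : e <= restraint n e.
Proof. by elim: e => // e IH; apply: leq_ltn_trans IH (restraint_lt _ _). Qed.

Lemma flips_lim v e : exists N, forall n, N <= n -> (flips v n e <-> flips v N e).
Proof.
have [r [N Hr]] := restraint_lim e; have [[x [N' [_ H]]]|H] := least_lim e r.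
  exists (N + N') => n Nn; rewrite /flips /witness !Hr; try lia.
  have [xn ->] := H n ltac:(lia); have [xN ->] := H (N + N') ltac:(lia).
  by rewrite xn xN.
(* Without candidates the witness is the junk value [n], so [flips] fails at every such stage. *)
exists N => n Nn; rewrite /flips /witness !Hr // !least_none //.
by split=> -[]; rewrite ltnn.
Qed.

(** Only the finitely many requirements up to [v] matter, so their thresholds can be added up. *)
Lemma flipped_lim v : exists N, forall n, N <= n -> (flipped v n <-> flipped v N).
Proof.
suff [N HN] : exists N, forall n e, N <= n -> e < v.+1 -> (flips v n e <-> flips v N e).
  by exists N => n Nn; split=> -[e ev F]; exists e => //; apply/(HN n e Nn ev).
elim: v.+1 => [|m [N HN]]; first by exists 0.
have [N' HN'] := flips_lim v m; exists (N + N') => n e Nn.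
have lN : N + N' <= n by []; rewrite ltnS leq_eqVlt => /predU1P[->|em].
  by rewrite HN' ?(HN' (N + N')); [|lia..].
by rewrite HN ?(HN (N + N')); [|lia..].
Qed.

(** * Computability of the coloring *)

Lemma recpred_enumerated I X N : recfun I -> recfun X -> recfun N ->
  recpred (fun s => enumerated (I s) (X s) (N s)).
Proof.
move=> HI HX HN.
apply: (recfun_app (G := fun s => nat_of_bool `[< enumerated (nth 0 s 0) (nth 0 s 1)
   (nth 0 s 2) >]) (Fs := [:: I; X; N])) => //.
rewrite -/(recpred _) /enumerated; recursive.
  by apply: recpred_certificate; recursive.
by apply: recpred_listed; recursive.
Qed.

Lemma recpred_candidate E R N X : recfun E -> recfun R -> recfun N -> recfun X ->
  recpred (fun s => candidate (E s) (R s) (N s) (X s)).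
Proof.
move=> HE HR HN HX.
apply: (recfun_app (G := fun s => nat_of_bool `[< candidate (nth 0 s 0) (nth 0 s 1)
   (nth 0 s 2) (nth 0 s 3) >]) (Fs := [:: E; R; N; X])) => //.
rewrite -/(recpred _) /candidate; recursive.
  by apply: recfun_logn3; recursive.
by apply: recpred_enumerated; recursive.
Qed.

Lemma recfun_least N E R : recfun N -> recfun E -> recfun R ->
  recfun (fun s => least (N s) (E s) (R s)).
Proof.
move=> HN HE HR.
apply: (recfun_app (G := fun s => least (nth 0 s 0) (nth 0 s 1) (nth 0 s 2))
  (Fs := [:: N; E; R])) => //.
apply: (recfun_find (P := fun x s => candidate (nth 0 s 1) (nth 0 s 2) (nth 0 s 0) x)).
  by recursive.
by apply: recpred_candidate; recursive.
Qed.

Lemma recfun_restraint N E : recfun N -> recfun E ->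
  recfun (fun s => restraint (N s) (E s)).
Proof.
apply: (recfun_app2 (g := restraint)).
apply: (recfun_rec (B := fun e r s => if `[< least (nth 0 s 0) e r < nth 0 s 0 >]
  then (logn 3 (least (nth 0 s 0) e r)).+1 else r.+1)); try recfun_leaf.
have H : recfun (fun s => least (nth 0 (behead (behead s)) 0) (nth 0 s 0) (nth 0 s 1)).
  by apply: recfun_least; recursive.
apply: recfun_if; recursive; exact: recfun_logn3.
Qed.

Lemma recfun_witness N E : recfun N -> recfun E ->
  recfun (fun s => witness (N s) (E s)).
Proof. by move=> HN HE; apply: recfun_least => //; apply: recfun_restraint. Qed.

Lemma recpred_iff P Q : recpred P -> recpred Q -> recpred (fun s => P s <-> Q s).
Proof. by move=> HP HQ; apply: recpred_and; apply: recpred_imp. Qed.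

Lemma recpred_low_digit1 F : recfun F -> recpred (fun s => low_digit1 (F s)).
Proof.
apply: (recfun_app1 (g := fun n => nat_of_bool `[< low_digit1 n >])).
rewrite -/(recpred _).
have H : recpred (fun s => 0 < nth 0 s 0 /\ exists2 q, q < (nth 0 s 0).+1 &
   nth 0 s 0 = 3 ^ logn 3 (nth 0 s 0) * (q * 3 + 1)).
  by recursive; apply: recfun_logn3; recursive.
apply: recpred_ext H => s; case: posnP => [->|n0]; last first.
  by rewrite low_digit1P //; split=> [[]|].
by split=> [[]|].
Qed.

Lemma recpred_flipped V N : recfun V -> recfun N ->
  recpred (fun s => flipped (V s) (N s)).
Proof.
apply: (recfun_app2 (g := fun v n => nat_of_bool `[< flipped v n >])).
rewrite -/(recpred _) /flipped /flips; recursive.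
- by apply: recfun_witness; recursive.
- by apply: recfun_logn3; apply: recfun_witness; recursive.
apply: recpred_iff; last by recursive.
by apply: recpred_low_digit1; apply: recfun_witness; recursive.
Qed.

Lemma recfun_computable f : recfun (fun s => f (nth 0 s 0)) -> computable_fun f.
Proof.
(* The single input is padded with zeros to the length that [p] requires. *)
move=> [p [k Hp]]; exists (Comp p (Proj 0 :: nseq k Zero)) => n _.
apply: eval_comp (Hp k.+1 [:: n] (leqnSn k)); first by rewrite size_mkseq /= size_nseq.
move=> i; rewrite /= size_nseq => ik; rewrite nth_mkseq //.
case: i ik => [_|i ik]; first exact: (eval_proj (i := 0) (s := [:: n])).
rewrite /= nth_nseq if_same nth_nil; exact: eval_zero.
Qed.

Lemma computable_color : computable_coloring color.
Proof.
apply: recfun_computable; rewrite -/(recpred _).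
apply: (recfun_ext (F := fun s => nat_of_bool
 `[< ~ (low_digit1 (nth 0 s 0) <-> flipped (logn 3 (nth 0 s 0)) (nth 0 s 0)) >])) => [s|].
  rewrite /color; congr nat_of_bool; rewrite -[RHS]asboolb; apply: asbool_equiv_eq.
  by case: (asboolP (flipped _ _)); case: low_digit1 => /= f;
    split=> // H; by [case: H | exfalso; case: H | case=> [??]; auto].
apply: recpredN; apply: recpred_iff; first by apply: recpred_low_digit1; recursive.
by apply: recpred_flipped; first apply: recfun_logn3; recursive.
Qed.

(** * Infinite computable sets are not monochromatic *)

Lemma infinite_nat_gt (X : set nat) N : infinite_set X -> exists2 x, X x & N < x.
Proof.
move=> Xinf; apply: contrapT => H; apply: Xinf.
apply: (@sub_finite_set _ _ `I_N.+1); last exact: finite_II.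
by move=> x Xx /=; rewrite ltnS leqNgt; apply/negP => Nx; apply: H; exists x.
Qed.

Lemma FS_le2_elt (X : set nat) x : X x -> FS_le 2 X x.
Proof.
move=> Xx; exists [fset x]%fset; last by rewrite big_seq_fset1.
by split; [move=> y; rewrite /= inE => /eqP -> | rewrite cardfs1].
Qed.

Lemma FS_le2_sum (X : set nat) x y : X x -> X y -> x != y -> FS_le 2 X (x + y).
Proof.
move=> Xx Xy xy; exists [fset x; y]%fset.
  by split; [move=> z; rewrite /= !inE => /orP[]/eqP -> | rewrite cardfs2 xy].
by rewrite big_fsetU1 ?inE //= big_seq_fset1.
Qed.

(** Past [N] the flip at level [v] is the same for [x] and [x + y], while the digit changes. *)
Lemma color_add_logn_eq x y N v : 0 < x -> 0 < y -> N <= x ->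
  logn 3 x = v -> logn 3 y = v -> low_digit1 x = low_digit1 y ->
  (forall n, N <= n -> (flipped v n <-> flipped v N)) ->
  color x <> color (x + y).
Proof.
move=> x0 y0 Nx vx vy dxy HN; have [L D] := add_logn_eq x0 y0 (etrans vx (esym vy)) dxy.
rewrite /color L D vx .
rewrite (asbool_equiv_eq (HN x Nx)).
rewrite (asbool_equiv_eq (HN (x + y) (leq_trans Nx (leq_addr _ _)))).
by case: (low_digit1 x) `[< _ >] => [] [].
Qed.

Lemma eval_enumerated (X : set nat) p x : X `<=` posnat ->
  (forall n, posnat n -> eval p [:: n] (n \in X)) -> X x ->
  exists n, enumerated (code p) x n.
Proof.
move=> Xpos Hp Xx; have := Hp x (Xpos x Xx); rewrite mem_set // => /derivable_complete.
move=> [n [w [c l]]]; exists (n + w), w; first lia.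
by split=> //; apply: certificate_leq c; apply: leq_addr.
Qed.

(** As [p] halts on [x], [certificate_sound] makes the certified value 1 equal to the truth value of
    membership. *)
Lemma enumerated_sound (X : set nat) p x n :
  (forall n, posnat n -> eval p [:: n] (n \in X)) -> 0 < x ->
  enumerated (code p) x n -> X x.
Proof.
move=> Hp x0 [w _ [c l]]; have := certificate_sound c (Hp x x0) l.
by case: (boolP (x \in X)) => /= [/set_mem|].
Qed.

Lemma unbounded_not_monochromatic (X : set nat) : X `<=` posnat ->
    computable_set X ->
    (forall v, exists2 x, X x & v <= logn 3 x) ->
  ~ monochromatic color (FS_le 2 X).
Proof.
move=> Xpos [p Hp] Xv mono.
(* If the sums are monochromatic, their color is that of any element [z]; requirement [e] pairs this
   color with the program deciding [X]. *)
have [z Xz _] := Xv 0; pose e := pr (code p) (color z).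
have [r [N Hr]] := restraint_lim e.
have [[x [N' [[x0 [rx [i _ [a _ [/pr_inj[<- _] en]]]]] H]]]|H] := least_lim e r; last first.
  (* An element of level at least [r] is eventually seen to be accepted, so [e] cannot lack
     candidates. *)
  have [x Xx rx] := Xv r; have [n en] := eval_enumerated Xpos Hp Xx.
  apply: (H n x); split; first exact: Xpos.
  split=> //; exists (code p); first by rewrite ltnS leq_prl.
  exists (color z); first by rewrite ltnS leq_prr.
  by [].
have Xx := enumerated_sound Hp x0 en.
have [y Xy [xy Ny]] : exists2 y, X y & logn 3 x < logn 3 y /\ N + N' <= y.
  (* A large level also makes [y] itself large, since the corresponding power of 3 divides [y]. *)
  have [y Xy yv] := Xv (maxn (logn 3 x).+1 (N + N')); exists y => //.
  move: yv; rewrite geq_max => /andP[-> yv]; split=> //.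
  apply: leq_trans yv _; apply: ltnW; have y0 := Xpos y Xy.
  by rewrite (leq_trans (ltn_expl (logn 3 y) (isT : 1 < 3))) // dvdn_leq // pfactor_dvdnn.
have [L D] := add_logn_lt x0 (Xpos y Xy) xy.
have [Nxy N'xy] : N <= x + y /\ N' <= x + y by lia.
have [Wlt lE] := H _ N'xy; have W : witness (x + y) e = x by rewrite /witness Hr.
(* At stage [x + y] the witness of [e] is [x], and by [witness_inj] no other requirement acts at its
   level. *)
have F : flipped (logn 3 x) (x + y) <-> (low_digit1 x <-> color z).
  have -> : (low_digit1 x <-> color z) <-> flips (logn 3 x) (x + y) e.
    rewrite /flips W; split=> [E|[_ [_ ->]]].
      do 2!split=> //; rewrite E; split=> [c|[j _ /pr_inj[_]]]; last by case: (color z).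
      by exists (code p); [rewrite ltnS leq_prl | rewrite /e c].
    split=> [[j _ /pr_inj[_]]|c]; first by case: (color z).
    by exists (code p); [rewrite ltnS leq_prl | rewrite /e c].
  split=> [[e' _ fl]|fl].
    suff -> : e = e' by [].
    by apply: (witness_inj _ fl.1); rewrite W // fl.2.1.
  exists e => //; rewrite ltnS -W; apply: leq_trans (restraint_geq (x + y) e) _.
  by rewrite W Hr.
(* With d the digit test of [x], the color of [x + y] is d xor (d iff [color z]), which is the
   negation of [color z]. *)
have := mono (x + y) z (FS_le2_sum Xx Xy _) (FS_le2_elt Xz).
rewrite {1}/color L D => C.
have ne : x != y by apply/eqP => E; rewrite E ltnn in xy.
have {}C := C ne.
rewrite (asbool_equiv_eq F) in C.
by case: asboolP C; case: (low_digit1 x) (color z) => [] []; intuition.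
Qed.

Theorem corollary2p2 :
  exists c : nat -> bool, computable_coloring c /\
    forall X : set nat, X `<=` posnat -> infinite_set X -> computable_set X ->
      ~ monochromatic c (FS_le 2 X).
Proof.
exists color; split=> [|X Xpos Xinf Xcomp]; first exact: computable_color.
have [Xv|Xv] := pselect (forall v, exists2 x, X x & v <= logn 3 x).
  exact: unbounded_not_monochromatic.
have [v Hv] : exists v, forall N, exists2 x, X x /\ logn 3 x = v & N < x.
  (* If each level had only boundedly many elements, then by induction on [v] all large elements
     would have level at least [v], and the levels would be unbounded. *)
  apply: contrapT => H; apply: Xv => v.
  have [N HN] : exists N, forall x, X x -> N < x -> v <= logn 3 x.
    elim: v => [|v [N IH]]; first by exists 0.
    have [N' HN'] : exists N', forall x, X x -> logn 3 x = v -> x <= N'.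
      apply: contrapT => H'; apply: H; exists v => N'; apply: contrapT => H''.
      apply: H'; exists N' => x Xx xv; rewrite leqNgt; apply/negP => Nx.
      by apply: H''; exists x.
    exists (N + N') => x Xx Nx; rewrite ltn_neqAle IH //; last lia.
    by rewrite andbT; apply/eqP => xv; have := HN' x Xx (esym xv); lia.
  by have [x Xx Nx] := infinite_nat_gt N Xinf; exists x => //; apply: HN.
have [N HN] := flipped_lim v => mono.
have noeq x y : X x -> X y -> N < x -> x < y -> logn 3 x = v -> logn 3 y = v ->
    low_digit1 x <> low_digit1 y.
  move=> Xx Xy Nx xy vx vy dxy.
  apply: (color_add_logn_eq (Xpos x Xx) (Xpos y Xy) (ltnW Nx) vx vy dxy HN).
  apply: mono; first exact: FS_le2_elt.
  by apply: FS_le2_sum => //; rewrite ltn_eqF.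
(* Among three elements of level [v], two share their digit, which [noeq] forbids. *)
have [x [Xx vx] Nx] := Hv N; have [y [Xy vy] xy] := Hv x; have [z [Xz vz] yz] := Hv y.
have xz := ltn_trans xy yz; have Ny := ltn_trans Nx xy.
have := noeq x y Xx Xy Nx xy vx vy; have := noeq x z Xx Xz Nx xz vx vz.
have := noeq y z Xy Xz Ny yz vy vz.
by case: (low_digit1 x) (low_digit1 y) (low_digit1 z) => [] [] [].
Qed.
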